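(* Let $1<p<\infty$, let $r,s$ be (real or complex) numbers, and let $U(s,r,s)$ be the bounded linear operator on $bv_p$ defined by the symmetric tri-band matrix with $r$ on the main diagonal and $s$ on the first super- and sub-diagonals. Let $U^*(s,r,s)$ denote its adjoint, acting on the dual space $bv_p^*$. Then: (i) $\sigma_p\left(U(s,r,s),bv_p\right)=\varnothing$; (ii) $\sigma_p\left(U^*(s,r,s),bv_p^*\right)=\varnothing$; (iii) $\sigma_r\left(U(s,r,s),bv_p\right)=\varnothing$; (iv) $\sigma_c\left(U(s,r,s),bv_p\right)=[r-2s,\,r+2s]$.
   Context: $[r-2s,r+2s]=\{r+2s\cos\theta:\theta\in[0,2\pi]\}$ is the line segment in $\mathbb{C}$ joining $r-2s$ and $r+2s$. $\mathbb{N}=\{0,1,2,\dots\}$. $bv_p$ is the complex Banach space of all complex sequences $x=(x_k)_{k\in\mathbb{N}}$ with $\sum_k|x_k-x_{k+1}|^p<\infty$, with norm $\|x\|_{bv_p}=\left(\sum_{k=0}^\infty|x_k-x_{k-1}|^p\right)^{1/p}$, where $x_{-1}=0$. The operator $U(s,r,s)$ acts by $(U(s,r,s)x)_k=sx_{k-1}+rx_k+sx_{k+1}$ for $k\in\mathbb{N}$, with the convention $x_{-1}=0$. For a bounded linear operator $T$ on a complex Banach space $X$, the adjoint $T^*$ is the bounded operator on the dual $X^*$ given by $(T^*\phi)(x)=\phi(Tx)$ for $\phi\in X^*$, $x\in X$. The point spectrum $\sigma_p(T,X)$ is the set of $\lambda\in\mathbb{C}$ such that $T-\lambda I$ is not injective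 (eigenvalues). The residual spectrum $\sigma_r(T,X)$ is the set of $\lambda$ such that $T-\lambda I$ is injective but its range is not dense in $X$. The continuous spectrum $\sigma_c(T,X)$ is the set of $\lambda$ such that $T-\lambda I$ is injective with dense range but $(T-\lambda I)^{-1}$, defined on that range, is not bounded. (The subscripts $p$, $r$, $c$ of $\sigma$ stand for ''point'', ''residual'', ''continuous''.)
   Formalization: The hypothesis s ≠ 0 is added: for s = 0 the operator U is r times the identity, so r is an eigenvalue of U and of its adjoint and the continuous spectrum is empty, which makes (i), (ii) and (iv) false. *)

(* Defs.v *)
From HB Require Import structures.
From mathcomp Require Import all_boot all_order all_algebra.
From mathcomp Require Import complex.
From mathcomp Require Import all_classical all_reals all_analysis.
From mathcomp Require Import ring.

Set Implicit Arguments.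
Unset Strict Implicit.
Unset Printing Implicit Defensive.

Import Order.TTheory GRing.Theory Num.Theory.
Import numFieldNormedType.Exports.

Local Open Scope classical_set_scope.
Local Open Scope complex_scope.
Local Open Scope ring_scope.

Section dual.
Context {K : numFieldType} (X : normedModType K).

(* Topological dual: continuous linear functionals. Only its vector space
   structure is set up, which is all that eigenvalues involve. *)
Definition dual_pred : {pred X -> K^o} :=
  [pred phi : X -> K^o | `[< linear phi /\ continuous phi >] ].

Record dual := Dual {
  dual_fun :> X -> K^o ;
  dual_funP : dual_fun \in dual_pred }.

HB.instance Definition _ := [isSub for dual_fun].
HB.instance Definition _ := [Choice of dual by <:].

Lemma dual_submod_closed : submod_closed dual_pred.
Proof.
split.
  apply/asboolP; split; last by move=> x; exact: cvg_cst.
  by move=> a u v; rewrite /= scaler0 addr0.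
move=> a f g /asboolP[fl fc] /asboolP[gl gc]; apply/asboolP; split.
  move=> b u v; rewrite !fctE /= fl gl !scalerDr !scalerA mulrC.
  by rewrite -!addrA; congr (_ + _); rewrite addrCA.
move=> x; rewrite /continuous_at.
have -> : a *: f + g = (fun z => a *: f z + g z) by [].
by apply: cvgD; [apply: cvgZl_tmp; exact: fc|exact: gc].
Qed.

HB.instance Definition _ :=
  GRing.isSubmodClosed.Build K (X -> K^o) dual_pred dual_submod_closed.
HB.instance Definition _ := [SubChoice_isSubLmodule of dual by <:].

Section adjoint.
Variables (T : {linear X -> X}) (T_cont : continuous T).

Lemma adjoint_subproof (phi : dual) : (phi \o T : X -> K^o) \in dual_pred.
Proof.
have /asboolP[fl fc] := dual_funP phi; apply/asboolP; split.
  by move=> a u v /=; rewrite linearP fl.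
by move=> x; apply: continuous_comp; [exact: T_cont|exact: fc].
Qed.

Definition adjoint (phi : dual) : dual := Dual (adjoint_subproof phi).

End adjoint.
End dual.

Arguments adjoint {K X} T T_cont phi.

Definition point_spectrum {K : numFieldType} {X : lmodType K} (T : X -> X) :
    set K :=
  [set l | ~ injective (fun x => T x - l *: x)].

Section spectrum.
Context {K : numFieldType} {X : normedModType K}.
Implicit Types T S : X -> X.

(* For S injective, 'pinv_(fun=> 0) setT S restricted to range S is S^{-1};
   its values off range S (here 0) are not constrained. *)
Definition bounded_inverse S : Prop :=
  exists M : K, forall y, range S y ->
    `| 'pinv_(fun=> 0) setT S y | <= M * `| y |.

Definition residual_spectrum T : set K :=
  [set l | let S x := T x - l *: x in injective S /\ ~ dense (range S)].

Definition continuous_spectrum T : set K :=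
  [set l | let S x := T x - l *: x in
    [/\ injective S, dense (range S) & ~ bounded_inverse S]].

End spectrum.

Definition csegment {R : realType} (r s : R[i]) : set R[i] :=
  [set r + 2 * s * (cos theta)%:C | theta in `[0, 2 * pi] ].

(* lag x k is x_{k-1}, with the convention x_{-1} = 0. *)
Definition lag {V : zmodType} (x : nat -> V) (k : nat) : V :=
  if k is k'.+1 then x k' else 0.

Section bv.
Context {R : realType}.
Local Notation C := (R[i]).
Local Notation normc := (@Normc.normc R).
Implicit Types x y : nat -> C^o.

Definition psum (p : R) (a : nat -> R) : \bar R :=
  (\sum_(0 <= k <oo) (a k `^ p)%:E)%E.

Definition bv_pred (p : R) of 1 < p : {pred nat -> C^o} :=
  [pred x : nat -> C^o |
    `[< (psum p (fun k => normc (x k - x k.+1)%R) < +oo)%E >] ].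

Definition bdiff x (k : nat) : C^o := x k - lag x k.

Section lp.
Variable p : R.
Hypothesis p_gt1 : 1 < p.
Implicit Types a b : nat -> R.

Let p_gt0 : 0 < p. Proof. exact: lt_trans p_gt1. Qed.
Let p_neq0 : p != 0. Proof. by rewrite gt_eqF. Qed.
Let pV_neq0 : p^-1 != 0. Proof. by rewrite invr_eq0. Qed.
Let pV_ge0 : 0 <= p^-1. Proof. by rewrite invr_ge0 ltW. Qed.
Let pow_ge0 a k : (0 <= (a k `^ p)%:E)%E.
Proof. by rewrite lee_fin powR_ge0. Qed.

Local Notation S := (psum p).
Definition pnorm a : \bar R := (S a `^ p^-1)%E.
Local Notation N := pnorm.

Lemma psum_ge0 a : (0 <= S a)%E.
Proof. exact: nneseries_ge0. Qed.

Lemma pnorm_lty a : (N a < +oo)%E <-> (S a < +oo)%E.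
Proof. by split; [exact: lty_poweRy|exact: poweR_lty]. Qed.

Lemma le_psum a b : (forall k, 0 <= a k <= b k) -> (S a <= S b)%E.
Proof.
move=> ab; apply: lee_nneseries => [k _ _|k _]; first exact: pow_ge0.
have /andP[a0 akb] := ab k.
rewrite lee_fin; apply: ge0_ler_powR => //; first exact: ltW.
by rewrite nnegrE (le_trans a0).
Qed.

Lemma psumE a : (forall k, 0 <= a k) ->
  S a = (\sum_(0 <= k <oo) `| (a k)%:E | `^ p)%E.
Proof.
by move=> a0; apply: eq_eseriesr => k _; rewrite abse_EFin ger0_norm.
Qed.

Lemma psumZ c a : 0 <= c -> (forall k, 0 <= a k) ->
  S (fun k => c * a k) = ((c `^ p)%:E * S a)%E.
Proof.
move=> c0 a0; rewrite -nneseriesZl; last by move=> k _; exact: pow_ge0.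
by apply: eq_eseriesr => k _; rewrite powRM// EFinM.
Qed.

Lemma psum_recl a : S a = ((a 0%N `^ p)%:E + S (fun k => a k.+1))%E.
Proof.
rewrite [LHS]nneseries_recl; [|by move=> k _; exact: pow_ge0|by []].
congr +%E; rewrite -(nneseries_addn 1); last exact: pow_ge0.
by apply: eq_eseriesr => k _; rewrite addn1.
Qed.

Lemma psum_ge_term a k : ((a k `^ p)%:E <= S a)%E.
Proof.
rewrite [leRHS](@nneseriesD1 _ _ k) => [|j _|//]; last exact: pow_ge0.
by apply: leeDl; apply: nneseries_ge0 => j _ _; exact: pow_ge0.
Qed.

Local Opaque psum.

Lemma pnorm_ge0 a : (0 <= N a)%E. Proof. exact: poweR_ge0. Qed.

Lemma le_pnorm a b : (S a <= S b)%E -> (N a <= N b)%E.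
Proof.
by apply: gt0_ler_poweR; rewrite ?in_itv/= ?psum_ge0 ?leey.
Qed.

Lemma pnormE a : (forall k, 0 <= a k) ->
  N a = ('N[counting]_p%:E [EFin \o a])%E.
Proof. by move=> a0; rewrite (Lnorm_counting _ p_gt0) /pnorm psumE. Qed.

Lemma pnormZ c a : 0 <= c -> (forall k, 0 <= a k) ->
  N (fun k => c * a k) = (c%:E * N a)%E.
Proof.
move=> c0 a0; rewrite /pnorm psumZ// poweRM ?lee_fin ?powR_ge0 ?psum_ge0//.
by rewrite poweR_EFin -powRrM mulfV// powRr1.
Qed.

Local Opaque pnorm.

Lemma pnormD a b : (forall k, 0 <= a k) -> (forall k, 0 <= b k) ->
  (N (fun k => (a k + b k)%R) <= N a + N b)%E.
Proof.
move=> a0 b0; rewrite (pnormE a0) (pnormE b0) pnormE; last first.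
  by move=> k; rewrite addr_ge0.
by apply: minkowski_EFin => //; exact: ltW.
Qed.

Lemma psum_lag a : S (lag a) = S a.
Proof. by rewrite psum_recl powR0// add0e. Qed.

Lemma psum_tail a : (S (fun k => a k.+1) <= S a)%E.
Proof. by rewrite [leRHS]psum_recl leeDr// pow_ge0. Qed.

Lemma normc_ge0 (z : C) : 0 <= normc z.
Proof. by case: z => a b; rewrite /= sqrtr_ge0. Qed.

Let d x (k : nat) : R := normc (bdiff x k).
Let d_ge0 x k : 0 <= d x k. Proof. exact: normc_ge0. Qed.

Lemma bv_predE x :
  (x \in bv_pred p_gt1) <-> (N (fun k => normc (bdiff x k)) < +oo)%E.
Proof.
have tE : S (fun k => d x k.+1) = S (fun k => normc (x k - x k.+1)).
  congr S; apply/funext => k.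
  by rewrite /d /bdiff/= -normcN opprB.
rewrite pnorm_lty; split.
- by move=> /asboolP xoo; rewrite psum_recl tE lte_add_pinfty// ltry.
- move=> xoo; apply/asboolP; rewrite -tE.
  exact: le_lt_trans (psum_tail _) xoo.
Qed.

Let N_dP (c : C) x y :
  (N (d (c *: x + y)%R) <= (normc c)%:E * N (d x) + N (d y))%E.
Proof.
rewrite -(pnormZ (normc_ge0 c) (d_ge0 x)).
apply: le_trans (pnormD _ _); last 2 first.
- by move=> k; rewrite mulr_ge0// normc_ge0.
- exact: d_ge0.
apply/le_pnorm/le_psum => k; rewrite d_ge0/= /d -Normc.normcM.
apply: le_trans (le_normcD _ _).
suff -> : bdiff (c *: x + y) k = c * bdiff x k + bdiff y k by [].
case: k => [|k]; rewrite /bdiff !fctE /= ?subr0//.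
by rewrite opprD mulrBr addrACA.
Qed.

Lemma bv_submod_closed : submod_closed (bv_pred p_gt1).
Proof.
split.
  apply/bv_predE/pnorm_lty.
  suff /le_lt_trans : (S (d 0%R) <= (0 `^ p)%:E * S (d 0%R))%E.
    by apply; rewrite powR0// mul0e ltry.
  rewrite -psumZ//; apply: le_psum => k; rewrite d_ge0 mul0r /=.
  suff -> : d 0 k = 0 by [].
  rewrite /d -[RHS](Normc.normc0 R); congr (normc _).
  by rewrite /bdiff; case: k => [|k]; exact: subrr.
move=> c x y /bv_predE xoo /bv_predE yoo; apply/bv_predE.
apply: le_lt_trans (N_dP _ _ _) _.
by rewrite lte_add_pinfty// lte_mul_pinfty// lee_fin normc_ge0.
Qed.

HB.instance Definition _ :=
  GRing.isSubmodClosed.Build C (nat -> C^o) (bv_pred p_gt1) bv_submod_closed.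

(* The proof of 1 < p is a parameter of the type because the normed space
   structure below (Minkowski) needs it. *)
Record bv := BV {
  bv_seq :> nat -> C^o ;
  bv_seqP : bv_seq \in bv_pred p_gt1 }.

HB.instance Definition _ := [isSub for bv_seq].
HB.instance Definition _ := [Choice of bv by <:].
HB.instance Definition _ := [SubChoice_isSubLmodule of bv by <:].

Definition bv_norm (x : bv) : R :=
  fine (psum p (fun k => normc (x k - lag x k))) `^ p^-1.

Lemma bv_norm_ge0 (x : bv) : 0 <= bv_norm x. Proof. exact: powR_ge0. Qed.

Local Transparent pnorm.
Lemma bv_normE (x : bv) : (bv_norm x)%:E = N (fun k => normc (bdiff x k)).
Proof.
have /bv_predE/pnorm_lty xoo := bv_seqP x.
rewrite /pnorm -[in RHS](@fineK _ (S (d x))); first by rewrite poweR_EFin.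
by rewrite ge0_fin_numE ?psum_ge0.
Qed.

Lemma bv_norm_eq0 (x : bv) : bv_norm x = 0 -> x = 0.
Proof.
move=> x0.
have Sd0 : S (d x) = 0%E.
  apply: (@poweR_eq0_eq0 _ _ p^-1); first exact: psum_ge0.
  by rewrite -[LHS]/(N (d x)) -bv_normE x0.
have d0 k : bdiff x k = 0.
  apply: Normc.eq0_normc; rewrite -[LHS]/(d x k).
  have /eqP : (d x k `^ p)%:E = 0%E.
    by apply/eqP; rewrite eq_le pow_ge0 andbT -Sd0 psum_ge_term.
  by rewrite eqe powR_eq0 p_neq0 andbT => /eqP.
apply/val_inj/funext; elim=> [|k IHk].
  by have := d0 0%N; rewrite /bdiff /= subr0.
by have := d0 k.+1; rewrite /bdiff /= IHk subr0.
Qed.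

Local Opaque pnorm bv_norm.

Lemma bv_normD (x y : bv) : bv_norm (x + y) <= bv_norm x + bv_norm y.
Proof.
have := N_dP 1 x y; rewrite scale1r Normc.normc1 mul1e => xy.
have aux (A B D : \bar R) (a b c : R) :
    a%:E = A -> b%:E = B -> c%:E = D -> (A <= B + D)%E -> a <= b + c.
  by move=> <- <- <-; rewrite -EFinD lee_fin.
exact: aux (bv_normE (x + y)) (bv_normE x) (bv_normE y) xy.
Qed.

Lemma bv_normZ (c : C) (x : bv) : bv_norm (c *: x) = normc c * bv_norm x.
Proof.
have aux (A B : \bar R) (a b e : R) :
    a%:E = A -> b%:E = B -> A = (e%:E * B)%E -> a = e * b.
  by move=> <- <-; rewrite -EFinM => -[].
apply: aux (bv_normE (c *: x)) (bv_normE x) _.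
rewrite -(pnormZ (normc_ge0 c) (d_ge0 x)).
congr N; apply/funext => k; rewrite /d -Normc.normcM; congr (normc _).
have cxE j : (c *: x : bv) j = c * x j by [].
have clE : lag (c *: x : bv) k = c * lag x k.
  by case: k => [|k]; [rewrite /= mulr0|exact: cxE].
by rewrite /bdiff cxE clE mulrBr.
Qed.

Let bv_normrD (x y : bv) :
  (bv_norm (x + y))%:C <= (bv_norm x)%:C + (bv_norm y)%:C.
Proof. by rewrite -(rmorphD (real_complex R)) lecR bv_normD. Qed.

Let bv_normrZ (c : C) (x : bv) : (bv_norm (c *: x))%:C = `|c| * (bv_norm x)%:C.
Proof. by rewrite bv_normZ (rmorphM (real_complex R)). Qed.

Let bv_normr0_eq0 (x : bv) : (bv_norm x)%:C = 0 -> x = 0.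
Proof. by move=> /(congr1 (@complex.Re R)) /bv_norm_eq0. Qed.

HB.instance Definition _ :=
  Lmodule_isNormed.Build C bv bv_normrD bv_normrZ bv_normr0_eq0.

Section triband.
Variables r s : C.

Definition triband_seq x (k : nat) : C^o :=
  s * lag x k + r * x k + s * x k.+1.

Let M : R := normc r + 3 * normc s.

Let N_triband (x : bv) : (N (d (triband_seq x)) <= (M * bv_norm x)%:E)%E.
Proof.
pose u := d x.
have u0 k : 0 <= u k by exact: d_ge0.
have lag0 k : 0 <= lag u k by case: k.
have r0 := normc_ge0 r; have s0 := normc_ge0 s.
pose w k := lag u k + (u k.+1 + u k).
have w0 k : 0 <= w k by rewrite !addr_ge0.
have Nu : N u = (bv_norm x)%:E by rewrite bv_normE.
have Nw : (N w <= (3 * bv_norm x)%:E)%E.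
  apply: le_trans (pnormD lag0 _) _; first by move=> k; rewrite addr_ge0.
  have -> : (3 * bv_norm x)%:E = (N u + (N u + N u))%E.
    by rewrite Nu -!EFinD; congr EFin; ring.
  apply: leeD; first by apply: le_pnorm; rewrite psum_lag.
  apply: le_trans (pnormD (fun k => u0 k.+1) u0) _.
  by apply: leeD => //; apply: le_pnorm; exact: psum_tail.
apply: (@le_trans _ _ (N (fun k => normc r * u k + normc s * w k))).
  apply/le_pnorm/le_psum => k; rewrite d_ge0/=.
  have normc3 (a b c e : C) : normc (a + (b + (c + e))) <=
      normc a + (normc b + (normc c + normc e)).
    apply: le_trans (le_normcD _ _) _; rewrite lerD2l.
    apply: le_trans (le_normcD _ _) _; rewrite lerD2l.
    exact: le_normcD.
  rewrite /w !mulrDr.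
  case: k => [|k].
    rewrite /= mulr0 add0r /u /d -!Normc.normcM.
    apply: le_trans (le_trans (normc3 (r * bdiff x 0%N) 0
      (s * bdiff x 1%N) (s * bdiff x 0%N)) _); last first.
      by rewrite Normc.normc0 add0r.
    rewrite le_eqVlt; apply/orP; left; apply/eqP; congr (normc _).
    by rewrite /bdiff /triband_seq /=; ring.
  rewrite /= /u /d -!Normc.normcM.
  apply: le_trans (le_trans (normc3 (r * bdiff x k.+1) (s * bdiff x k)
      (s * bdiff x k.+2) 0) _); last first.
    by rewrite Normc.normc0 addr0 !lerD2l lerDl normc_ge0.
  rewrite le_eqVlt; apply/orP; left; apply/eqP; congr (normc _).
  by rewrite /bdiff /triband_seq /=; ring.
apply: le_trans (pnormD _ _) _; try by move=> k; rewrite mulr_ge0.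
rewrite !pnormZ//.
rewrite /M mulrDl EFinD; apply: leeD; first by rewrite Nu.
rewrite [3 * _]mulrC -mulrA EFinM.
by apply: lee_pmul => //; rewrite ?lee_fin// pnorm_ge0.
Qed.

Lemma triband_subproof (x : bv) : triband_seq x \in bv_pred p_gt1.
Proof. by apply/bv_predE; apply: le_lt_trans (N_triband x) _; rewrite ltry. Qed.

Definition triband (x : bv) : bv := BV (triband_subproof x).

Lemma triband_linear : linear triband.
Proof.
move=> c x y; apply/val_inj/funext => k.
have vE j : (c *: x + y : bv) j = c * x j + y j by [].
have lE : lag (c *: x + y : bv) k = c * lag x k + lag y k.
  by case: k => [|k]; [rewrite /= mulr0 addr0|exact: vE].
have aux (a a1 b b1 e e1 : C) : s * (c * a + a1) + r * (c * b + b1) +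
    s * (c * e + e1) = c * (s * a + r * b + s * e) + (s * a1 + r * b1 + s * e1).
  by ring.
rewrite [LHS]/(s * lag (c *: x + y : bv) k + r * (c *: x + y : bv) k +
  s * (c *: x + y : bv) k.+1) lE !vE.
exact: aux.
Qed.

HB.instance Definition _ :=
  GRing.isLinear.Build C bv bv *:%R triband triband_linear.

Lemma triband_bounded (x : bv) : bv_norm (triband x) <= M * bv_norm x.
Proof. by rewrite -lee_fin bv_normE; exact: N_triband. Qed.

Lemma triband_continuous : continuous triband.
Proof.
apply/linear_bounded_continuous/bounded_funP => e.
exists (M%:C * e) => x xe.
have M0 : 0 <= M by rewrite addr_ge0 ?mulr_ge0 ?normc_ge0.
apply: (@le_trans _ _ (M%:C * (bv_norm x)%:C)).
  by rewrite -(rmorphM (real_complex R)) lecR triband_bounded.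
by apply: ler_wpM2l xe; rewrite lecR.
Qed.

End triband.
End lp.
End bv.

Arguments triband {R p} p_gt1 r s x.
Arguments triband_continuous {R p} p_gt1 r s.

(* Main.v *)
(* Passing from [x] to its differences [y_k = x_k - x_(k-1)] identifies [bv_p]
   with [l^p] and turns [U(s,r,s) - (r + s m)] into [s (T - m)], where
   [(T y)_k = y_(k-1) + y_(k+1)] with the reflecting condition [y_(-1) = y_0].
   Write [m = z + 1/z] with [0 < |z| <= 1]; the segment is [|z| = 1].

   - [T - m] is injective: if [T y = m y], then
     [y_(k+1)^2 - m y_k y_(k+1) + y_k^2] does not depend on [k]; it tends to [0]
     and equals [(2 - m) y_0^2].
   - For [v_w = (w^k)_k] with [|w| < 1],
     [(T - m) v_w = (w + 1/w - m) v_w + (1 - 1/w) e_0].  Taking [w = z] when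
     [|z| < 1], and [w -> z] radially when [|z| = 1] (here [p > 1] makes the
     first term negligible), [e_0] is in the closure of the range; the
     recurrence then puts every [e_k] there, so the range is always dense.
     This empties the residual spectrum and the point spectrum of the adjoint.
   - When [|z| = 1], the norms of [v_w] blow up while those of [(T - m) v_w]
     stay bounded, so the inverse is unbounded; when [|z| < 1], [T - m] factors
     through two contracting first-order recurrences and is bounded below. *)

Require Import Defs.
From mathcomp Require Import all_boot all_order all_algebra.
From mathcomp Require Import complex.
From mathcomp Require Import all_classical all_reals all_analysis.
From mathcomp Require Import ring lra.

Set Implicit Arguments.
Unset Strict Implicit.
Unset Printing Implicit Defensive.

Import Order.TTheory GRing.Theory Num.Theory.
Import numFieldNormedType.Exports.

Local Open Scope classical_set_scope.
Local Open Scope complex_scope.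
Local Open Scope ring_scope.

(** * Sequence norms in [l^p]: absorption, tails, geometric sequences *)

Section pnorm.
Context {R : realType} {p : R} (p_gt1 : 1 < p).
Implicit Types a b : nat -> R.
Local Notation N := (pnorm p).

Let p_gt0 : 0 < p. Proof. exact: lt_trans p_gt1. Qed.

Let pV_gt0 : 0 < p^-1. Proof. by rewrite invr_gt0. Qed.

Lemma pnorm_mono a b : (forall k, 0 <= a k <= b k) -> (N a <= N b)%E.
Proof. by move=> ab; apply/le_pnorm/le_psum. Qed.

Lemma pnorm_ge_term a k : (forall k, 0 <= a k) -> ((a k)%:E <= N a)%E.
Proof.
move=> a0; have := psum_ge_term p a k.
move=> /(gt0_ler_poweR (ltW pV_gt0)); rewrite !in_itv /= !leey !andbT.
rewrite lee_fin powR_ge0 psum_ge0 => /(_ isT isT) /=.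
by rewrite -powRrM mulfV ?gt_eqF// powRr1.
Qed.

(** The shifted sequence repeats [a 0], so its norm can exceed that of [a]; only finiteness is
    kept. *)
Lemma pnorm_predn_lty a : (N a < +oo)%E -> (N (fun k => a k.-1) < +oo)%E.
Proof.
rewrite !pnorm_lty // => aoo; rewrite psum_recl.
by rewrite (_ : psum _ _ = psum p a)// lte_add_pinfty ?ltry.
Qed.

(** Minkowski gives [N a <= q * N a + N b]; since [N a] is finite, the first term can be moved to
    the left. This is how contracting recurrences are solved below. *)
Lemma pnorm_absorb (q : R) a a' b : 0 <= q ->
    (forall k, 0 <= a k) -> (forall k, 0 <= a' k) -> (forall k, 0 <= b k) ->
    (N a < +oo)%E -> (N a' <= N a)%E ->
    (forall k, a k <= q * a' k + b k) ->
  ((1 - q)%:E * N a <= N b)%E.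
Proof.
move=> q0 a0 a'0 b0 aoo a'a H.
have : (N a <= q%:E * N a + N b)%E.
  apply: (@le_trans _ _ (N (fun k => q * a' k + b k))).
    by apply: pnorm_mono => k; rewrite a0 H.
  apply: le_trans (pnormD p_gt1 _ b0) _; first by move=> k; rewrite mulr_ge0.
  by rewrite pnormZ// leeD2r// lee_wpmul2l.
have Nafin : N a \is a fin_num by rewrite ge0_fin_numE// pnorm_ge0.
rewrite -(fineK Nafin); case: (N b) => [v| |] //=; rewrite ?leey//.
by rewrite -!EFinM -EFinD !lee_fin; lra.
Qed.

Lemma psum_tailE a n : psum p (fun k => if (k < n)%N then 0 else a k) =
  (\sum_(n <= k <oo) (a k `^ p)%:E)%E.
Proof.
rewrite -nneseries_addn; last by move=> k; rewrite lee_fin powR_ge0.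
rewrite -[RHS]/(psum p (fun k => a (k + n)%N)).
elim: n a => [|n IH] a; first by congr psum; apply/funext => k; rewrite addn0.
rewrite psum_recl /= powR0 ?gt_eqF// add0e.
rewrite (_ : (fun k => a (k + n.+1)%N) = fun k => a (k + n).+1); last first.
  by apply/funext => k; rewrite addnS.
by rewrite -(IH (fun k => a k.+1)).
Qed.

Lemma pnorm_tail a (e : R) : 0 < e -> (N a < +oo)%E ->
  exists n, (N (fun k => if (k < n)%N then 0%R else a k) < e%:E)%E.
Proof.
move=> e0; rewrite pnorm_lty// => aoo.
have a0 : forall k : nat, xpredT k -> (0 <= (a k `^ p)%:E)%E.
  by move=> k _; rewrite lee_fin powR_ge0.
have ep : (0 < (e `^ p)%:E)%E by rewrite lte_fin powR_gt0.
(* The tails of the convergent series tend to [0], hence eventually fall below [e ^ p]. *)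
have [n _ /(_ n (leqnn n)) /=] := nneseries_tail_cvg aoo a0
  (open_nbhs_nbhs (conj (@open_ereal_lt_ereal _ (e `^ p)%:E) ep)).
rewrite -psum_tailE => tn; exists n.
rewrite /pnorm (_ : e%:E = ((e `^ p)%:E `^ p^-1)%E); last first.
  by rewrite poweR_EFin -powRrM mulfV ?gt_eqF// powRr1// ltW.
have tfin : psum p (fun k => if (k < n)%N then 0 else a k) \is a fin_num.
  by rewrite ge0_fin_numE ?psum_ge0// (lt_trans tn)// ltry.
move: tn (psum_ge0 p (fun k => if (k < n)%N then 0 else a k)).
rewrite -(fineK tfin) !poweR_EFin lte_fin lee_fin => tn t0.
by rewrite lte_fin gt0_ltr_powR// nnegrE// ltW.
Qed.

Lemma pnorm_cvg0 a (e : R) : 0 < e -> (forall k, 0 <= a k) -> (N a < +oo)%E ->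
  exists n, forall k, (n <= k)%N -> a k < e.
Proof.
move=> e0 a0 /(pnorm_tail e0)[n tn]; exists n => k nk.
rewrite -lte_fin; apply: le_lt_trans tn.
pose b k := if (k < n)%N then 0 else a k.
have -> : a k = b k by rewrite /b ltnNge nk.
by apply: (@pnorm_ge_term b) => j; rewrite /b; case: ifP.
Qed.

(* Parametrizing the ratio [q] by [t = 1 - q `^ p] makes the norm explicit. *)
Lemma pnorm_geometric (t : R) : 0 < t <= 1 ->
  N (fun k => ((1 - t) `^ p^-1) ^+ k) = (t `^ (- p^-1))%:E.
Proof.
move=> /andP[t0 t1].
have q0 : 0 <= 1 - t by rewrite subr_ge0.
suff psE : psum p (fun k => ((1 - t) `^ p^-1) ^+ k) = (t^-1)%:E.
  by rewrite /pnorm psE poweR_EFin -powR_inv1 ?ltW// -powRrM mulN1r.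
have q1 : `|1 - t| < 1 by rewrite ger0_norm//; lra.
have := cvg_geometric_series (a := 1) q1.
rewrite opprB addrCA subrr addr0 mul1r => geo.
apply/cvg_lim => //.
rewrite (_ : (fun _ => _) = EFin \o series (geometric 1 (1 - t))).
  by apply: cvg_EFin; [near=> x|exact: geo].
apply/funext => n /=; rewrite /series /= -sumEFin; apply: eq_bigr => k _.
rewrite mul1r -powR_mulrn ?powR_ge0// -!powRrM.
by rewrite mulrA mulrAC mulVf ?gt_eqF// mul1r powR_mulrn.
Unshelve. all: by end_near. Qed.

End pnorm.

Lemma normc_real {R : realType} (a : R) : Normc.normc a%:C = `|a|.
Proof. by rewrite /= expr0n addr0 sqrtr_sqr. Qed.

Lemma normc_eq1 {R : realType} (a b : R) :
  Normc.normc (a +i* b) = 1 <-> a ^+ 2 + b ^+ 2 = 1.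
Proof.
split=> /= [ab|->]; last exact: sqrtr1.
by rewrite -[LHS]sqr_sqrtr ?ab ?expr1n// addr_ge0 ?sqr_ge0.
Qed.

Local Opaque Normc.normc psum pnorm bv_norm.

(** * The space [bv_p] read through the differences of its elements *)

Section bv_theory.
Context {R : realType} {p : R} (p_gt1 : 1 < p).
Local Notation C := (R[i]).
Local Notation B := (bv p_gt1).
Local Notation normc := (@Normc.normc R).
Local Notation N y := (pnorm p (fun k : nat => normc (y k))).

Lemma bdiffP (c : C) (x y : B) k :
  bdiff (c *: x + y : B) k = c * bdiff x k + bdiff y k.
Proof.
have vE j : (c *: x + y : B) j = c * x j + y j by [].
have lE : lag (c *: x + y : B) k = c * lag x k + lag y k.
  by case: k => [|k]; [rewrite /= mulr0 addr0|exact: vE].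
by rewrite /bdiff vE lE opprD mulrBr addrACA.
Qed.

Lemma bdiff0 k : bdiff (0 : B) k = 0.
Proof. by case: k => [|k]; exact: subrr. Qed.

Lemma bdiffZ (c : C) (x : B) k : bdiff (c *: x : B) k = c * bdiff x k.
Proof. by rewrite -[c *: x]addr0 bdiffP bdiff0 addr0. Qed.

Lemma bdiffB (x y : B) k : bdiff (x - y : B) k = bdiff x k - bdiff y k.
Proof. by rewrite addrC -scaleN1r bdiffP mulN1r addrC. Qed.

Lemma bdiff_inj (x y : B) : bdiff x =1 bdiff y -> x = y.
Proof.
move=> xy; apply/val_inj/funext; elim=> [|k IHk].
  by have := xy 0%N; rewrite /bdiff /= !subr0.
by have := xy k.+1; rewrite /bdiff /= IHk => /addIr.
Qed.

Lemma bdiff_surj (y : nat -> C) : (N y < +oo)%E ->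
  exists x : B, bdiff x =1 y.
Proof.
(* Partial sums invert [bdiff]. *)
move=> yoo; pose x k : C^o := \sum_(i < k.+1) y i.
have xE k : bdiff x k = y k.
  case: k => [|k]; rewrite /bdiff /x /=.
    by rewrite big_ord_recr big_ord0 /= add0r subr0.
  by rewrite big_ord_recr /= addrAC subrr add0r.
have xP : x \in bv_pred p_gt1.
  apply/bv_predE; rewrite (_ : (fun _ => _) = (fun k => normc (y k)))//.
  by apply/funext => k; rewrite xE.
by exists (BV xP).
Qed.

Lemma bdiff_lty (x : B) : (N (bdiff x) < +oo)%E.
Proof. by rewrite -bv_normE ltry. Qed.

Lemma bv_normrE (x : B) : `|x| = (bv_norm x)%:C.
Proof. by []. Qed.

Lemma bv_normN (x : B) : bv_norm (- x) = bv_norm x.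
Proof. by rewrite -scaleN1r bv_normZ normcN Normc.normc1 mul1r. Qed.

Lemma bv_norm0 : bv_norm (0 : B) = 0.
Proof. by rewrite -(scale0r (0 : B)) bv_normZ Normc.normc0 mul0r. Qed.

Lemma normc_gt0 (z : C) : (0 < normc z) = (z != 0).
Proof.
rewrite lt_def normc_ge0 andbT; congr (~~ _); apply/eqP/eqP => [|->].
  exact: Normc.eq0_normc.
exact: Normc.normc0.
Qed.

(** It is the differences that are truncated: [y] is eventually constant, not finitely supported. *)
Lemma bv_norm_truncation (x : B) (e : R) : 0 < e -> exists n, forall y : B,
  (forall k, bdiff y k = if (k < n)%N then bdiff x k else 0) ->
  bv_norm (x - y) < e.
Proof.
move=> e0; have [n nP] := pnorm_tail p_gt1 e0 (bdiff_lty x).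
exists n => y yE; rewrite -lte_fin bv_normE.
apply: le_lt_trans nP; rewrite le_eqVlt; apply/orP; left; apply/eqP.
congr pnorm; apply/funext => k; rewrite bdiffB yE.
by case: ifP => _; rewrite ?subrr ?Normc.normc0 ?subr0.
Qed.

(* Under [bdiff], [U(s,r,s)] becomes a Jacobi matrix on [l^p] with reflecting
   boundary condition [y_(-1) = y_0]; the latter is what [0.-1 = 0] encodes. *)
Lemma bdiff_triband_sub (r s m : C) (x : B) k :
  bdiff (triband p_gt1 r s x - (r + s * m) *: x : B) k =
  s * (bdiff x k.+1 - m * bdiff x k + bdiff x k.-1).
Proof.
rewrite bdiffB bdiffZ.
by case: k => [|[|k]]; rewrite /bdiff /= /triband_seq /=; ring.
Qed.

(** * The shifted operator: injectivity, and a lower bound when [|z| < 1] *)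

Variables r s m : C.
Hypothesis s_neq0 : s != 0.

Local Notation S x := (triband p_gt1 r s x - (r + s * m) *: x).

Let SE (x : B) k :
  bdiff (S x) k = s * (bdiff x k.+1 - m * bdiff x k + bdiff x k.-1).
Proof. exact: bdiff_triband_sub. Qed.

Let SP (c : C) (x y : B) : S (c *: x + y) = c *: S x + S y.
Proof. by apply: bdiff_inj => k; rewrite bdiffP !SE !bdiffP; ring. Qed.

Lemma triband_sub_ker x : S x = 0 -> x = 0.
Proof.
move=> Sx0; pose y := bdiff x.
have rec k : y k.+1 - m * y k + y k.-1 = 0.
  by apply: (mulfI s_neq0); rewrite -SE Sx0 mulr0 bdiff0.
(* a conserved quantity of the three-term recurrence *)
pose Q k := y k.+1 ^+ 2 - m * (y k * y k.+1) + y k ^+ 2.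
have y1 : y 1%N = (m - 1) * y 0%N.
  by have /= := rec 0%N => h; apply/eqP; rewrite -subr_eq0 -h; apply/eqP; ring.
have yS k : y k.+2 = m * y k.+1 - y k.
  by have /= := rec k.+1 => h; apply/eqP; rewrite -subr_eq0 -h; apply/eqP; ring.
have QE k : Q k = (2 - m) * y 0%N ^+ 2.
  elim: k => [|k <-]; first by rewrite /Q y1; ring.
  by rewrite /Q yS; ring.
have y_small e : 0 < e -> exists n, forall k, (n <= k)%N -> normc (y k) < e.
  move=> e0.
  by have := pnorm_cvg0 p_gt1 e0 (fun k => normc_ge0 (y k)) (bdiff_lty x).
have y00 : y 0%N = 0.
  (* For [m = 2] the conserved quantity is [0] and says nothing about [y 0]; there [y] is constant,
     hence [0] because it tends to [0]. *)
  have [m2|m2] := eqVneq m 2.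
    have yc k : y k = y 0%N.
      suff : y k.+1 = y k /\ y k = y 0%N by case.
      elim: k => [|k [IH1 IH2]]; first by rewrite y1 m2; split => //; ring.
      by rewrite yS IH1 IH2 m2; split => //; ring.
    apply: Normc.eq0_normc; apply: contrapT => /eqP y0.
    have y0' : 0 < normc (y 0%N) by rewrite lt_def y0 normc_ge0.
    by have [n /(_ n (leqnn n))] := y_small _ y0'; rewrite yc ltxx.
  suff Q0 : Q 0%N = 0.
    move/eqP: Q0; rewrite QE mulf_eq0 subr_eq0 eq_sym (negPf m2) /=.
    by rewrite expf_eq0 => /eqP.
  apply: Normc.eq0_normc; apply: contrapT => /eqP q0.
  have q0' : 0 < normc (Q 0%N) by rewrite lt_def q0 normc_ge0.
  (* If [|y n|] and [|y (n+1)|] are below [e <= 1], then [|Q n| < e * (2 + |m|) <= |Q 0|], against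
     the constancy of [Q]. *)
  pose K := 2 + normc m.
  have K0 : 0 < K by rewrite ltr_wpDr// normc_ge0.
  pose e := Num.min 1 (normc (Q 0%N) / K).
  have e0 : 0 < e by rewrite lt_min ltr01 divr_gt0.
  have [n nP] := y_small e e0.
  have := nP n (leqnn _); have := nP n.+1 (leqnSn _).
  have : normc (Q 0%N) = normc (Q n) by rewrite !QE.
  rewrite {2}/Q => QE0.
  have : normc (Q 0%N) <= normc (y n.+1) ^+ 2 + normc m *
     (normc (y n) * normc (y n.+1)) + normc (y n) ^+ 2.
    rewrite QE0 !expr2 -!Normc.normcM -[normc (m * _)]normcN.
    apply: le_trans (le_normcD _ _) _; rewrite lerD2r.
    exact: le_normcD.
  have eQ : e * K <= normc (Q 0%N) by rewrite -ler_pdivlMr// ge_min lexx orbT.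
  have e1 : e <= 1 by rewrite ge_min lexx.
  move=> qle bd ad.
  have a0 := normc_ge0 (y n); have b0 := normc_ge0 (y n.+1).
  have b2 : normc (y n.+1) ^+ 2 < e.
    apply: (le_lt_trans _ bd); apply: ler_iXnr => //.
    exact: ltW (lt_le_trans bd e1).
  have a2 : normc (y n) ^+ 2 < e.
    apply: (le_lt_trans _ ad); apply: ler_iXnr => //.
    exact: ltW (lt_le_trans ad e1).
  have ab : normc m * (normc (y n) * normc (y n.+1)) <= normc m * e.
    apply: ler_wpM2l; first exact: normc_ge0.
    apply: (le_trans _ (ltW ad)); apply: ler_piMr => //.
    exact: ltW (lt_le_trans bd e1).
  have : normc (Q 0%N) < e * K.
    by apply: (le_lt_trans qle); rewrite /K mulrDr; lra.
  by rewrite ltNge eQ.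
apply: bdiff_inj => k.
rewrite bdiff0.
suff : y k = 0 /\ y k.+1 = 0 by case.
elim: k => [|k [IH1 IH2]]; first by rewrite y1 y00 mulr0.
by rewrite IH2 yS IH1 IH2 mulr0 subr0.
Qed.

Lemma triband_sub_bounded_below (z : C) : z != 0 -> normc z < 1 ->
  m = z + z^-1 -> exists K, forall x, bv_norm x <= K * bv_norm (S x).
Proof.
move=> z0 z1 mE.
have z1' : 1 - z != 0.
  by apply: contraTneq z1 => /subr0_eq <-; rewrite Normc.normc1 ltxx.
(* Each of the two first-order recurrences costs a factor [1 / (1 - |z|)]; [z / s] multiplies the
   source term of the first, and the factor with [1 - z] comes from the boundary term of the
   second. *)
exists ((1 + (normc (1 - z))^-1) * normc (z / s) / (1 - normc z) ^+ 2) => x.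
set c := 1 + _; set g := normc (z / s); set q := normc z in z1 *.
have q0 : 0 <= q by exact: normc_ge0.
have c0 : 0 <= c by rewrite addr_ge0// invr_ge0 normc_ge0.
(* With [d_k = y_k - z y_(k-1)], the second-order recurrence for [y] splits
   into two first-order ones, each contracting by [|z|]. *)
pose y := bdiff x; pose d k := y k - z * y k.-1.
have dE k : d k = z * d k.+1 + - (z / s) * bdiff (S x) k.
  by rewrite SE mE /d /y /=; field; rewrite z0 s_neq0.
have doo : (N d < +oo)%E.
  apply: (@le_lt_trans _ _ (N y + (q%:E * N (fun k => y k.-1)))%E).
    rewrite -(pnormZ p_gt1 q0); last by move=> k; exact: normc_ge0.
    apply: le_trans (pnormD p_gt1 _ _); last 2 first.
    - by move=> k; exact: normc_ge0.
    - by move=> k; rewrite mulr_ge0// normc_ge0.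
    apply: pnorm_mono => // k; rewrite normc_ge0 /d /=.
    apply: le_trans (le_normcD _ _) _.
    by rewrite normcN Normc.normcM.
  have yoo : (N y < +oo)%E := bdiff_lty x.
  apply: lte_add_pinfty; first exact: yoo.
  apply: lte_mul_pinfty; [by rewrite lee_fin|by []|].
  exact: (@pnorm_predn_lty _ _ p_gt1 (fun k => normc (y k))).
(* The recurrence for [d] runs backwards, from [k + 1] to [k]; dropping the first term does not
   increase the norm. *)
have dle : ((1 - q)%:E * N d <= g%:E * (bv_norm (S x))%:E)%E.
  rewrite bv_normE -(pnormZ p_gt1 (normc_ge0 (z / s))); last first.
  - by move=> k; exact: normc_ge0.
  apply: (@pnorm_absorb _ _ p_gt1 q _ (fun k => normc (d k.+1))) => //.
  - by move=> k; exact: normc_ge0.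
  - by move=> k; exact: normc_ge0.
  - by move=> k; rewrite mulr_ge0 ?normc_ge0.
  - by apply/(le_pnorm p_gt1)/(psum_tail p (fun k => normc (d k))).
  - move=> k; rewrite {1}dE /g -(normcN (z / s)) -!Normc.normcM.
    exact: le_normcD.
have yle : ((1 - q)%:E * N y <= c%:E * N d)%E.
  rewrite -(pnormZ p_gt1 c0); last by move=> k; exact: normc_ge0.
  apply: (@pnorm_absorb _ _ p_gt1 q _ (lag (fun k => normc (y k)))) => //.
  - by move=> k; exact: normc_ge0.
  - by case=> [|k] //=; exact: normc_ge0.
  - by move=> k; rewrite mulr_ge0 ?normc_ge0.
  - exact: bdiff_lty.
  - by apply: (le_pnorm p_gt1); rewrite (psum_lag p_gt1).
  (* At [k = 0] the reflecting condition gives [d 0 = (1 - z) * y 0], whence the inverse of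
     [|1 - z|] in [c]. *)
  - case=> [|k] /=.
      rewrite mulr0 add0r /d /= -{2}[y 0%N]mul1r -mulrBl Normc.normcM.
      rewrite /c mulrDl mul1r mulrA mulVf ?mul1r ?lerDr ?mulr_ge0 ?normc_ge0//.
      by rewrite gt_eqF// normc_gt0.
    have -> : y k.+1 = z * y k + d k.+1 by rewrite /d /= addrC subrK.
    apply: le_trans (le_normcD _ _) _.
    rewrite Normc.normcM lerD2l /c mulrDl mul1r lerDl.
    by rewrite mulr_ge0 ?invr_ge0 ?normc_ge0.
have dfin : N d \is a fin_num by rewrite ge0_fin_numE// pnorm_ge0.
move: yle dle; rewrite -bv_normE -(fineK dfin) -!EFinM !lee_fin.
set D := fine _; set nx := bv_norm x; set nS := bv_norm _ => yle dle.
have q1 : 0 < 1 - q by rewrite subr_gt0.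
rewrite mulrAC ler_pdivlMr ?exprn_gt0// expr2.
rewrite mulrA [nx * _]mulrC -!mulrA.
apply: (@le_trans _ _ ((c * D) * (1 - q))).
  by rewrite mulrA ler_wpM2r// ltW.
by rewrite -!mulrA ler_wpM2l// mulrC.
Qed.

(** * Geometric almost-eigenvectors, and unboundedness of the inverse when [|z| = 1] *)

Lemma triband_sub_geometric (w : C) (v b : B) : w != 0 ->
    (forall k, bdiff v k = w ^+ k) -> (forall k, bdiff b k = (k == 0)%:R) ->
  S v = (s * (w + w^-1 - m)) *: v + (s * (1 - w^-1)) *: b.
Proof.
move=> w0 vE bE; apply: bdiff_inj => k.
rewrite SE bdiffP bdiffZ !vE bE; case: k => [|k] /=; first by ring.
by rewrite !exprS; field.
Qed.

(** Once [S v] is scaled to have [e_0]-coefficient [1], this quotient is the coefficient of [v] that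
    remains. The bound is uniform in [z], including [z = 1], where the denominator tends to [0] with
    [1 - h]. *)
Lemma normc_defect_le (z w : C) (h : R) : normc z = 1 -> 0 < h < 1 ->
    w = h%:C * z ->
  normc ((w + w^-1 - (z + z^-1)) / (1 - w^-1)) <= 3 * (1 - h).
Proof.
move=> z1 /andP[h0 h1] wE.
have z0 : z != 0 by rewrite -normc_gt0 z1.
have hC : h%:C != 0 by rewrite -normc_gt0 normc_real normr_gt0 gt_eqF.
have w0 : w != 0 by rewrite wE mulf_neq0.
have nw : normc w = h by rewrite wE Normc.normcM z1 mulr1 normc_real gtr0_norm.
have w1 : w - 1 != 0.
  by apply: contraTneq h1 => /subr0_eq w1; rewrite -nw w1 Normc.normc1 ltxx.
have -> : (w + w^-1 - (z + z^-1)) / (1 - w^-1) =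
    (- (1 - h)%:C) * ((h%:C * z ^+ 2 - 1) / (w - 1)).
  rewrite rmorphB rmorph1; move: w1; rewrite wE => w1.
  by field; rewrite hC z0 w1.
rewrite Normc.normcM normcN normc_real ger0_norm; last by lra.
rewrite mulrC ler_wpM2r//; first by lra.
rewrite Normc.normcM Normc.normcV ler_pdivrMr ?normc_gt0//.
(* Each of the three summands has modulus at most [|w - 1|], because [1 - h = 1 - |w|]. *)
have -> : h%:C * z ^+ 2 - 1 = (w - 1) + (z * (w - 1) + (1 - h)%:C * z).
  by rewrite rmorphB rmorph1 wE; ring.
apply: le_trans (le_normcD _ _) _.
have := le_normcD (z * (w - 1)) ((1 - h)%:C * z).
rewrite !Normc.normcM z1 normc_real ger0_norm; last by lra.
have := le_normcD w (- (w - 1)).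
rewrite normcN opprB addrC subrK Normc.normc1 nw.
by move: (normc (w - 1)) (normc (z * _ + _)) => ? ?; lra.
Qed.

(* The almost-eigenvectors [(w^k)_k], with [w] approaching [z] radially. *)
Lemma approx_eigenvector (z : C) (e : R) :
    normc z = 1 -> m = z + z^-1 -> 0 < e ->
  exists (w : C) (v : B), [/\ w != 0, 1 - w^-1 != 0 & normc (1 - w^-1) <= 3] /\
    [/\ forall k, bdiff v k = w ^+ k,
      normc ((w + w^-1 - m) / (1 - w^-1)) * bv_norm v < e & e^-1 < bv_norm v].
Proof.
move=> z1 mE e0.
have p0 : 0 < p by exact: lt_trans p_gt1.
have pV0 : 0 < p^-1 by rewrite invr_gt0.
have pV1 : 0 < 1 - p^-1 by rewrite subr_gt0 invf_lt1.
have pV1' : 0 < (1 - p^-1)^-1 by rewrite invr_gt0.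
(* With [|w| ^ p = 1 - t] the norm of [v] is [t ^ (-1/p)] and the defect is at most [3 t]. The three
   bounds on [t] give in turn [1 / |w| <= 2], a product at most [3 t ^ (1 - 1/p) < e] (the exponent
   is positive as [p > 1]), and a norm above [1 / e]. *)
pose t := Num.min (2^-1) (Num.min ((e / 4) `^ (1 - p^-1)^-1) ((e / 2) `^ p)).
have t0 : 0 < t by rewrite !lt_min invr_gt0 ltr0n !powR_gt0// divr_gt0.
have t12 : t <= 2^-1 by rewrite ge_min lexx.
have te : 3 * (t * t `^ (- p^-1)) < e.
  have -> : t * t `^ (- p^-1) = t `^ (1 - p^-1).
    by rewrite powRD ?powRr1 ?ltW// (gt_eqF t0) implybT.
  have : t `^ (1 - p^-1) <= e / 4; last by lra.
  have -> : e / 4 = ((e / 4) `^ (1 - p^-1)^-1) `^ (1 - p^-1).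
    by rewrite -powRrM mulVf ?gt_eqF// powRr1// ltW// divr_gt0.
  apply: ge0_ler_powR; rewrite ?nnegrE ?powR_ge0 ?(ltW t0)
    ?(ltW pV0) ?(ltW pV1)//.
  by rewrite !ge_min lexx orbT.
have eV : e^-1 < t `^ (- p^-1).
  rewrite powRN ltf_pV2 ?posrE ?powR_gt0//.
  apply: (@le_lt_trans _ _ (e / 2)); last by lra.
  have -> : e / 2 = ((e / 2) `^ p) `^ p^-1.
    by rewrite -powRrM mulfV ?gt_eqF// powRr1// ltW// divr_gt0.
  apply: ge0_ler_powR; rewrite ?nnegrE ?powR_ge0 ?(ltW t0)
    ?(ltW pV0) ?(ltW pV1)//.
  by rewrite !ge_min lexx !orbT.
pose h := (1 - t) `^ p^-1.
have q0 : 0 < 1 - t by lra.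
have h1 : h < 1.
  have p11 : 1 = 1 `^ p^-1 :> R by rewrite powR1.
  rewrite /h [ltRHS]p11 gt0_ltr_powR ?nnegrE ?ler01 ?(ltW q0)//.
  by rewrite gtrDl oppr_lt0.
have ht : 1 - t <= h.
  have := @ge1r_powR _ h p; rewrite /h -powRrM mulVf ?gt_eqF//.
  rewrite powRr1 ?(ltW q0)//.
  apply; last exact: ltW.
  by rewrite powR_gt0//= ltW.
have h0 : 0 < h by exact: lt_le_trans ht.
pose w := h%:C * z.
have nw : normc w = h by rewrite Normc.normcM z1 mulr1 normc_real gtr0_norm.
have w0 : w != 0 by rewrite -normc_gt0 nw.
have Nw : N (fun k => w ^+ k) = (t `^ (- p^-1))%:E.
  rewrite -(pnorm_geometric p_gt1); last by rewrite t0; lra.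
  congr pnorm; apply/funext => k; rewrite -/h -nw.
  by elim: k => [|k IH]; rewrite ?Normc.normc1// !exprS Normc.normcM IH.
have [v vE] : exists v : B, bdiff v =1 (fun k => w ^+ k).
  by apply: bdiff_surj; rewrite Nw ltry.
have nv : bv_norm v = t `^ (- p^-1).
  apply: EFin_inj; rewrite bv_normE -Nw; congr pnorm; apply/funext => k.
  by rewrite vE.
exists w, v; split; split => //.
- rewrite subr_eq0 eq_sym invr_eq1; apply: contraTneq h1 => w1.
  by rewrite -nw w1 Normc.normc1 ltxx.
- apply: le_trans (le_normcD _ _) _.
  rewrite Normc.normc1 normcN Normc.normcV nw.
  have : h^-1 <= 2; last by lra.
  by rewrite invf_ple ?posrE//; lra.
- rewrite nv mE; apply: le_lt_trans te; rewrite mulrA ler_wpM2r ?powR_ge0//.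
  apply: le_trans (normc_defect_le z1 _ (erefl w)) _; first by rewrite h0.
  by lra.
- by rewrite nv.
Qed.

(** The witness is the constant sequence [1]; its differences are the geometric sequence of ratio
    [0], the case [t = 1]. *)
Lemma exists_bdiff_delta0 : exists b : B, forall k, bdiff b k = (k == 0)%:R.
Proof.
apply: bdiff_surj; rewrite [ltLHS](_ : _ = (1 `^ (- p^-1))%:E) ?ltry//.
rewrite -(pnorm_geometric p_gt1) ?ltr01 ?lexx//.
congr pnorm; apply/funext => k.
have p0 : p^-1 != 0 by rewrite invr_eq0 gt_eqF// (lt_trans _ p_gt1).
rewrite subrr powR0// expr0n.
by case: k => [|k]; rewrite ?Normc.normc1 ?Normc.normc0.
Qed.

Lemma triband_sub_not_bounded_below (z : C) : normc z = 1 -> m = z + z^-1 ->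
  ~ exists K, forall x, bv_norm x <= K * bv_norm (S x).
Proof.
move=> z1 mE [K KP].
have [b bE] := exists_bdiff_delta0.
have nb := bv_norm_ge0 b; have ns := normc_ge0 s.
(* [L] bounds [S v] for every almost-eigenvector whose defect times norm is at most [1]; taking
   [M >= 1] ensures this, while the norm of [v] exceeds [M >= |K| * L]. *)
pose L := normc s * (3 * (1 + bv_norm b)).
have L0 : 0 <= L by rewrite /L !mulr_ge0// addr_ge0.
have [M M1 KM] : exists2 M, 1 <= M & `|K| * L <= M.
  exists (`|K| * L + 1); last by rewrite lerDl ler01.
  by rewrite lerDr; apply: mulr_ge0.
have M0 : 0 < M := lt_le_trans ltr01 M1.
have MV : 0 < M^-1 by rewrite invr_gt0.
have [w [v [[w0 w1 w3] [vE v1]]]] := approx_eigenvector z1 mE MV.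
rewrite invrK ltNge => /negP; apply.
apply: le_trans KM; apply: (le_trans (KP v)).
apply: (@le_trans _ _ (`|K| * bv_norm (S v))).
  by apply: ler_wpM2r; [exact: bv_norm_ge0|exact: ler_norm].
apply: ler_wpM2l; first exact: normr_ge0.
rewrite (triband_sub_geometric w0 vE bE).
apply: le_trans (bv_normD _ _) _; rewrite !bv_normZ.
rewrite (Normc.normcM s (w + w^-1 - m)) (Normc.normcM s (1 - w^-1)) /L.
have := Normc.normcM ((w + w^-1 - m) / (1 - w^-1)) (1 - w^-1).
rewrite (divfK w1) => ->.
have M1' : M^-1 <= 1 by rewrite invf_le1.
have := ltW (lt_le_trans v1 M1').
have := normc_ge0 (1 - w^-1); have := bv_norm_ge0 v.
have := normc_ge0 ((w + w^-1 - m) / (1 - w^-1)).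
move: nb ns w3; clear.
move: (normc s) (normc (1 - _)) (normc (_ / _)) (bv_norm b) (bv_norm v).
move=> a c d f g f0 a0 c3 d0 g0 c0 dg.
have dgc := ler_pM (mulr_ge0 d0 g0) c0 dg c3.
have cf := ler_wpM2r f0 c3.
rewrite -!mulrA -mulrDr; apply: ler_wpM2l => //.
by rewrite [c * g]mulrC mulrA; lra.
Qed.

(** * Density of the range: its closure [approx] is a closed subspace containing every [e_k] *)

Let approx (x : B) := forall e, 0 < e -> exists u, bv_norm (x - S u) < e.

Let approx_im u : approx (S u).
Proof. by move=> e e0; exists u; rewrite subrr bv_norm0. Qed.

Let approxP c x y : approx x -> approx y -> approx (c *: x + y).
Proof.
move=> ax ay e e0; have nc := normc_ge0 c.
have e1 : 0 < e / 2 / (normc c + 1) by rewrite !divr_gt0//; lra.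
have e2 : 0 < e / 2 by rewrite divr_gt0.
have [u uP] := ax _ e1; have [v vP] := ay _ e2.
exists (c *: u + v); rewrite SP opprD addrACA -scalerBr.
apply: le_lt_trans (bv_normD _ _) _; rewrite bv_normZ.
move: uP; rewrite ltr_pdivlMr; last by lra.
have := bv_norm_ge0 (x - S u); move: vP.
by move: (bv_norm _) (bv_norm _) => ? ?; lra.
Qed.

Let approx_closed x :
  (forall e, 0 < e -> exists2 y, approx y & bv_norm (x - y) < e) -> approx x.
Proof.
move=> H e e0; have e2 : 0 < e / 2 by rewrite divr_gt0.
have [y ay xy] := H _ e2; have [u uP] := ay _ e2; exists u.
have := bv_normD (x - y) (y - S u); rewrite addrA subrK => /le_lt_trans; apply.
by have := ltrD xy uP; rewrite -splitr.
Qed.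

Let approx_delta0 (z : C) (b : B) : z != 0 -> normc z <= 1 -> m = z + z^-1 ->
  (forall k, bdiff b k = (k == 0)%:R) -> approx b.
Proof.
move=> z0; rewrite le_eqVlt => /orP[/eqP z1|z1] mE bE e e0.
  have [w [v [[w0 w1 _] [vE v1 _]]]] := approx_eigenvector z1 mE e0.
  exists ((s * (1 - w^-1))^-1 *: v).
  have -> : S ((s * (1 - w^-1))^-1 *: v) = (s * (1 - w^-1))^-1 *: S v.
    by apply: bdiff_inj => k; rewrite bdiffZ !SE !bdiffZ; ring.
  rewrite (triband_sub_geometric w0 vE bE).
  rewrite scalerDr !scalerA mulVf ?mulf_neq0// scale1r opprD addrCA subrr addr0.
  rewrite bv_normN bv_normZ; apply: le_lt_trans v1.
  suff -> : (s * (1 - w^-1))^-1 * (s * (w + w^-1 - m)) =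
      (w + w^-1 - m) / (1 - w^-1) by [].
  by rewrite invfM mulrACA mulVf// mul1r mulrC.
(* Inside the disc [w = z] is allowed and cancels the term in [v], so [b] lies in the range
   itself. *)
have z1' : 1 - z^-1 != 0.
  rewrite subr_eq0 eq_sym invr_eq1; apply: contraTneq z1 => ->.
  by rewrite Normc.normc1 ltxx.
have p0 : 0 < p by exact: lt_trans p_gt1.
have nz : 0 < normc z by rewrite normc_gt0.
have [v vE] : exists v : B, bdiff v =1 (fun k => z ^+ k).
  apply: bdiff_surj; set t := 1 - normc z `^ p.
  rewrite [ltLHS](_ : _ = (t `^ (- p^-1))%:E) ?ltry//.
  have zp1 : normc z `^ p < 1.
    have p11 : 1 = 1 `^ p :> R by rewrite powR1.
    by rewrite [ltRHS]p11 gt0_ltr_powR ?nnegrE ?ler01 ?(ltW nz).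
  rewrite -(pnorm_geometric p_gt1); last first.
    by rewrite subr_gt0 zp1/= lerBlDr lerDl powR_ge0.
  congr pnorm; apply/funext => k.
  rewrite /t opprB addrCA subrr addr0 -powRrM mulfV ?gt_eqF// powRr1 ?ltW//.
  by elim: k => [|k IH]; rewrite ?Normc.normc1// !exprS Normc.normcM IH.
exists ((s * (1 - z^-1))^-1 *: v).
suff -> : S ((s * (1 - z^-1))^-1 *: v) = b by rewrite subrr bv_norm0.
have -> : S ((s * (1 - z^-1))^-1 *: v) = (s * (1 - z^-1))^-1 *: S v.
  by apply: bdiff_inj => k; rewrite bdiffZ !SE !bdiffZ; ring.
rewrite (triband_sub_geometric z0 vE bE) mE subrr mulr0 scale0r add0r.
by rewrite scalerA mulVf ?mulf_neq0// scale1r.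
Qed.

Let approx0 : approx 0.
Proof.
suff <- : S 0 = 0 by exact: approx_im.
by apply: bdiff_inj => k; rewrite SE !bdiff0; ring.
Qed.

Lemma triband_sub_dense (z : C) : z != 0 -> normc z <= 1 -> m = z + z^-1 ->
  forall x e, 0 < e -> exists u, bv_norm (x - S u) < e.
Proof.
move=> z0 z1 mE x.
have [b bE] := exists_bdiff_delta0.
have ab : approx b by exact: approx_delta0 z0 z1 mE bE.
(* The recurrence has order two, so the induction carries consecutive pairs: [e_(n+2) = S e_(n+1) /
   s + m e_(n+1) - e_n]. The reflecting condition replaces [m] by [m - 1] in the first step. *)
have deltas n : exists b0 b1 : B, [/\ approx b0, approx b1,
   forall k, bdiff b0 k = (k == n)%:R & forall k, bdiff b1 k = (k == n.+1)%:R].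
  elim: n => [|n [b0 [b1 [a0 a1 b0E b1E]]]].
    exists b, (s^-1 *: S b + ((m - 1) *: b + 0)).
    split; [exact: ab| |exact: bE|].
      exact: (approxP _ (approx_im b) (approxP _ ab approx0)).
    move=> k; rewrite !bdiffP SE !bE bdiff0.
    by case: k => [|[|k]] /=; field.
  exists b1, (s^-1 *: S b1 + (m *: b1 + (-1 *: b0 + 0))).
  split; [exact: a1| |exact: b1E|].
    exact: (approxP _ (approx_im b1) (approxP _ a1 (approxP _ a0 approx0))).
  move=> k; rewrite !bdiffP SE !b1E b0E bdiff0 eqSS.
  case: k => [|k] /=; first by field.
  by rewrite !eqSS; field.
have truncations n : exists2 y, approx y &
    forall k, bdiff y k = if (k < n)%N then bdiff x k else 0.
  elim: n => [|n [y ay yE]].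
    by exists 0; [exact: approx0|move=> k; rewrite bdiff0].
  have [b0 [_ [a0 _ b0E _]]] := deltas n.
  exists (bdiff x n *: b0 + y); first exact: (approxP _ a0 ay).
  move=> k; rewrite bdiffP yE b0E ltnS.
  by case: ltngtP => [_|_|->]; rewrite ?mulr0 ?mulr1 ?add0r ?addr0.
apply: approx_closed => e e0; have [n nP] := bv_norm_truncation x e0.
by have [y ay yE] := truncations n; exists y; [exact: ay|exact: nP].
Qed.

End bv_theory.

(** * The parametrization [m = z + 1/z] and the segment *)

Lemma exists_addV {R : realType} (m : R[i]) :
  exists z, [/\ z != 0, Normc.normc z <= 1 & m = z + z^-1].
Proof.
(* [z] and [z'] are the roots of [X^2 - m X + 1]; their product is [1], so one of them lies in the
   closed unit disc. *)
pose d := sqrtc (m ^+ 2 - 4); pose z := (m + d) / 2; pose z' := (m - d) / 2.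
have zz' : z * z' = 1.
  by rewrite /z /z' mulrACA [(m + d) * _]mulrC -subr_sqr sqr_sqrtc; field.
have z0 : z != 0.
  by apply: contra_eqN zz' => /eqP ->; rewrite mul0r eq_sym oner_neq0.
have z'E : z' = z^-1 by rewrite -[LHS](mulKf z0) zz' mulr1.
have mE : m = z + z^-1 by rewrite -z'E /z /z'; field.
have [z1|z1] := leP (Normc.normc z) 1; first by exists z.
exists z^-1; split; first by rewrite invr_eq0.
  by rewrite Normc.normcV invf_le1 ?ltW// (lt_trans ltr01).
by rewrite invrK addrC.
Qed.

(** On the unit circle [1/z] is the conjugate of [z], so [z + 1/z] is twice the real part,
    [2 cos theta]. *)
Lemma csegmentP {R : realType} (r s l : R[i]) : csegment r s l <->
  exists2 z, Normc.normc z = 1 & l = r + s * (z + z^-1).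
Proof.
have joukowski (a b : R) : a ^+ 2 + b ^+ 2 = 1 ->
    (a +i* b) + (a +i* b)^-1 = 2 * a%:C.
  move=> ab.
  have h : (a +i* b) * (a -i* b) = 1.
    apply/eqP; rewrite eq_complex /= mulrN opprK -!expr2 ab eqxx /=.
    by rewrite mulrN mulrC addNr.
  have nz : a +i* b != 0.
    by apply: contra_eqN h => /eqP ->; rewrite mul0r eq_sym oner_neq0.
  have -> : (a +i* b)^-1 = a -i* b.
    by apply: (mulfI nz); rewrite mulfV// h.
  by apply/eqP; rewrite eq_complex /=; apply/andP; split; apply/eqP; ring.
split.
  move=> [t _ <-]; exists (cos t +i* sin t).
    by apply/normc_eq1; exact: cos2Dsin2.
  by rewrite joukowski ?cos2Dsin2//; ring.
move=> [[a b] /normc_eq1 ab ->]; rewrite joukowski//.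
have a1 : -1 <= a <= 1 by have := sqr_ge0 b; nra.
(* The upper half circle already covers the segment, so an angle in [[0, pi]] is enough. *)
exists (acos a); last by rewrite acosK//; ring.
rewrite /= in_itv /= acos_ge0//= (le_trans (acos_lepi a1))//.
by rewrite ler_peMl ?pi_ge0// ler1n.
Qed.

(** Functionals with the same image agree on the range of [T - l]; being continuous, they agree
    everywhere when that range is dense. *)
Lemma adjoint_sub_injective {K : numFieldType} {X : normedModType K}
    (T : {linear X -> X}) (Tc : continuous T) (l : K) :
  dense (range (fun x => T x - l *: x)) ->
  injective (fun phi : dual X => adjoint T Tc phi - l *: phi).
Proof.
move=> dS phi psi eq_adj.
have [/asboolP[lphi cphi] /asboolP[lpsi cpsi]] :=
  (dual_funP phi, dual_funP psi).
have subE (f : dual X) : linear f -> forall x,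
    f (T x - l *: x) = (adjoint T Tc f - l *: f : dual X) x.
  by move=> lf x; rewrite addrC -scaleNr lf scaleNr addrC.
have eqS x : phi (T x - l *: x) = psi (T x - l *: x).
  by rewrite !subE// eq_adj.
apply/val_inj/funext => x; apply: contrapT => /eqP nx.
pose f y : K^o := phi y - psi y.
have cf : continuous f by move=> y; apply: cvgB; [exact: cphi|exact: cpsi].
have oO : open (f @^-1` ~` [set 0]).
  apply: open_comp => [y _|]; first exact: cf.
  apply/closed_openC/accessible_closed_set1/hausdorff_accessible.
  exact: norm_hausdorff.
have [|y [fy [u _ uE]]] := dS _ _ oO.
  by exists x => /eqP; rewrite subr_eq0 (negPf nx).
by apply: fy; rewrite /f -uE eqS subrr.
Qed.

(** * From norm estimates to the topological definitions of the spectra *)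

Section spectrum.
Context {R : realType} {p : R} (p_gt1 : 1 < p).
Local Notation B := (bv p_gt1).

Lemma dense_bv (A : set B) :
    (forall x e, 0 < e -> exists2 y, A y & bv_norm (x - y) < e) -> dense A.
Proof.
move=> H O [x Ox] oO.
have /nbhs_ballP[e /= e0] : nbhs x O by apply: open_nbhs_nbhs.
rewrite -ball_normE => eO.
(* Radii are complex here; positivity forces the imaginary part to vanish. *)
move: e0; case: e eO => [e i] eO; rewrite ltcE /= => /andP[/eqP i0 e0].
have [y Ay xy] := H x e e0; exists y; split => //; apply: eO => /=.
by rewrite bv_normrE ltcE /= i0 eqxx.
Qed.

Lemma bounded_inverseP (S : B -> B) : injective S ->
  bounded_inverse S <-> exists K, forall x, bv_norm x <= K * bv_norm (S x).
Proof.
move=> Sinj.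
have SK x : 'pinv_(fun=> 0) setT S (S x) = x.
  by apply: pinvKV; [move=> u v _ _ /Sinj|rewrite inE].
(* The norms being real, the real part [k] of the complex bound already bounds the inverse. *)
split=> [[[k i] kP]|[K KP]].
  exists k => x; have := kP (S x) (ex_intro2 _ _ x I erefl).
  rewrite SK !bv_normrE lecE => /andP[_] /=.
  by rewrite mulr0 subr0.
exists K%:C => _ [x _ <-]; rewrite SK !bv_normrE.
by rewrite -(rmorphM (real_complex R)) lecR.
Qed.

End spectrum.

(** For [s = 0] the operator is [r] times the identity and [r] is an eigenvalue, hence the
    assumption [s != 0]. *)
Theorem theorem4p3 (R : realType) (p : R) (p_gt1 : 1 < p) (r s : R[i])
    (s_neq0 : s != 0) :
  [/\ point_spectrum (triband p_gt1 r s) = set0,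
      point_spectrum
        (adjoint (triband p_gt1 r s) (triband_continuous p_gt1 r s)) = set0,
      residual_spectrum (triband p_gt1 r s) = set0 &
      continuous_spectrum (triband p_gt1 r s) = csegment r s].
Proof.
(* Every [l] takes the form [r + s * m], so the preceding results apply to all [l]. *)
have lE l : l = r + s * ((l - r) / s).
  by rewrite mulrCA mulfV// mulr1 addrC subrK.
have inj l : injective (fun x => triband p_gt1 r s x - l *: x).
  move=> x y; rewrite (lE l) => /eqP; rewrite -subr_eq0 => /eqP xy.
  apply/eqP; rewrite -subr_eq0; apply/eqP.
  apply: (triband_sub_ker (r := r) s_neq0 (m := (l - r) / s)).
  rewrite (linearB (triband p_gt1 r s)) scalerBr -[RHS]xy.
  by rewrite !opprB addrACA [RHS]addrACA [- _ - _]addrC.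
have dns l : dense (range (fun x => triband p_gt1 r s x - l *: x)).
  apply: dense_bv => x e e0; rewrite (lE l).
  have [z [z0 z1 mE]] := exists_addV ((l - r) / s).
  have [u uP] := triband_sub_dense r s_neq0 z0 z1 mE x e0.
  by exists (triband p_gt1 r s u - (r + s * ((l - r) / s)) *: u).
split.
- by rewrite -subset0 => l; apply; exact: inj.
- by rewrite -subset0 => l; apply; apply: adjoint_sub_injective; exact: dns.
- by rewrite -subset0 => l [_]; apply; exact: dns.
rewrite eqEsubset; split=> l.
  move=> [_ _ nb]; apply/csegmentP.
  have [z [z0 z1 mE]] := exists_addV ((l - r) / s).
  exists z; last by rewrite -mE -lE.
  (* If [|z| < 1], the lower bound would make the inverse bounded; hence [|z| = 1]. *)
  apply/eqP; rewrite eq_le z1 leNgt; apply/negP => z1'.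
  apply: nb; apply/(bounded_inverseP (inj l)).
  have := triband_sub_bounded_below p_gt1 r s_neq0 z0 z1' mE.
  by rewrite -lE.
move=> /csegmentP[z z1 zE]; split; [exact: inj|exact: dns|].
move=> /(bounded_inverseP (inj l)).
by rewrite zE; exact: (triband_sub_not_bounded_below z1 erefl).
Qed.
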